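(* Let $A_1A_2A_3A_4$ be a (non-degenerate) tetrahedron in $\mathbb{R}^3$, let $C>0$, let $k_{142},k_{203},k_{143},k_{423}$ be rational numbers, and for small $\epsilon$ let $A_0=A_0(\epsilon)$ be an interior point of the tetrahedron such that $$\alpha_{120}=\alpha_{124}-\epsilon,\quad \alpha_{102}=\alpha_{142}+k_{142}\epsilon,\quad \alpha_{203}=\alpha_{243}+k_{203}\epsilon,\quad \alpha_{103}=\alpha_{143}+k_{143}\epsilon,\quad \alpha_{023}=\alpha_{423}+k_{423}\epsilon.$$ Let $B_1(\epsilon),\dots,B_4(\epsilon)$ be the positive weights with sum $C$ for which $A_0(\epsilon)$ is the weighted Fermat-Torricelli point of $A_1A_2A_3A_4$. Then, as $\epsilon\to 0$, the weighted Fermat-Torricelli tree $\{A_1A_0(\epsilon),A_2A_0(\epsilon),A_3A_0(\epsilon),A_4A_0(\epsilon)\}$ becomes in the limit the degenerate weighted Fermat-Torricelli tree $\{A_1A_4,A_2A_4,A_3A_4\}$; that is, $A_0(\epsilon)\to A_4$.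
   Context: For points $A_l,A_m,A_n$ with $l,m,n\in\{0,1,2,3,4\}$, $\alpha_{lmn}$ denotes the angle $\angle A_lA_mA_n$ at $A_m$. Given weights $B_1,\dots,B_4\ge 0$ attached to the vertices, the weighted Fermat-Torricelli point of $A_1A_2A_3A_4$ is the (unique) point $X\in\mathbb{R}^3$ minimizing $\sum_{i=1}^4 B_i|XA_i|$. If this point $A_0$ is not a vertex, the weighted Fermat-Torricelli tree is the set of four segments $\{A_1A_0,A_2A_0,A_3A_0,A_4A_0\}$; if this point is a vertex, e.g. $A_4$, the tree is called degenerate and consists of the three edges $\{A_1A_4,A_2A_4,A_3A_4\}$ meeting at that vertex. *)

(* Defs.v *)
From HB Require Import structures.
From mathcomp Require Import all_boot all_order all_algebra.
From mathcomp Require Import all_classical all_reals all_analysis.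
Set Implicit Arguments.
Unset Strict Implicit.
Unset Printing Implicit Defensive.
Import Order.TTheory GRing.Theory Num.Theory.
Import numFieldNormedType.Exports.
Local Open Scope classical_set_scope.
Local Open Scope ring_scope.

(* The library norm on row vectors is the sup norm, so
   Euclidean lengths and angles are defined from the scalar product; the
   topology of 'rV[R]_3 (interior, limits) is the library's. *)

Definition dot3 (R : realType) (u v : 'rV[R]_3) : R :=
  \sum_(i < 3) u 0 i * v 0 i.

Definition eucl_dist (R : realType) (P Q : 'rV[R]_3) : R :=
  Num.sqrt (dot3 (P - Q) (P - Q)).

(* The angle at the middle point Q, in [0, pi] (meaningful for P != Q and
   S != Q). *)
Definition angle (R : realType) (P Q S : 'rV[R]_3) : R :=
  acos (dot3 (P - Q) (S - Q) / (eucl_dist P Q * eucl_dist S Q)).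

Definition nondegenerate_tetrahedron (R : realType) (A1 A2 A3 A4 : 'rV[R]_3) : bool :=
  free [:: A2 - A1; A3 - A1; A4 - A1].

Definition tetrahedron (R : realType) (A1 A2 A3 A4 : 'rV[R]_3)
    : set 'rV[R]_3 :=
  [set P | exists w1 w2 w3 w4 : R,
    [/\ [/\ 0 <= w1, 0 <= w2, 0 <= w3 & 0 <= w4],
        w1 + w2 + w3 + w4 = 1
      & P = w1 *: A1 + w2 *: A2 + w3 *: A3 + w4 *: A4]].

Definition is_fermat_torricelli (R : realType) (A1 A2 A3 A4 : 'rV[R]_3)
    (B1 B2 B3 B4 : R) (P : 'rV[R]_3) : Prop :=
  let total X := B1 * eucl_dist X A1 + B2 * eucl_dist X A2
               + B3 * eucl_dist X A3 + B4 * eucl_dist X A4 in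
  forall X : 'rV[R]_3, total P <= total X.

Definition segment (R : realType) (P Q : 'rV[R]_3) : set 'rV[R]_3 :=
  [set (1 - t) *: P + t *: Q | t in `[0, 1]%classic].

(* The underlying sets (unions of the segments) of the trees T e tend to that
   of L along the filter F, for the Hausdorff distance. *)
Definition tree_cvg (R : realType) (F : set_system R)
    (T : R -> set (set 'rV[R]_3)) (L : set (set 'rV[R]_3)) : Prop :=
  forall r : R, 0 < r -> \forall e \near F,
    (forall P, (\bigcup_(S in T e) S) P ->
       exists2 Q, (\bigcup_(S in L) S) Q & eucl_dist P Q < r) /\
    (forall Q, (\bigcup_(S in L) S) Q ->
       exists2 P, (\bigcup_(S in T e) S) P & eucl_dist P Q < r).

(* Main.v *)
(* The angles at [A2] and the angle [A1 A0 A2] alone force [A0 -> A4]. In the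
   triangle [A1 A2 A0] the side [A1 A2] is fixed and two angles converge to those
   of the triangle [A1 A2 A4], whose angle at [A4] has nonzero sine, so
   [|A2 A0| -> |A2 A4|]. The angles of [A2 A0] with [A2 A1] and [A2 A3] then give
   the limits of the scalar products of [A0 - A2] with [a = A1 - A2] and
   [b = A3 - A2]. The remaining one, with the normal [a x b], is known up to sign
   from the Gram determinant, and the sign is that of [A4] because [A0] lies in
   the tetrahedron. *)
Require Import Defs.
From HB Require Import structures.
From mathcomp Require Import all_boot all_order all_algebra.
From mathcomp Require Import all_classical all_reals all_analysis.
From mathcomp Require Import ring lra.
Import Order.TTheory GRing.Theory Num.Theory.
Import numFieldNormedType.Exports.
Local Open Scope classical_set_scope.
Local Open Scope ring_scope.

(** * Coordinates, cross product and Gram determinants *)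

Lemma dot3E {R : realType} (u v : 'rV[R]_3) :
  dot3 u v = u 0 0 * v 0 0 + u 0 1 * v 0 1 + u 0 2 * v 0 2.
Proof.
rewrite /dot3 !big_ord_recl big_ord0 addr0 addrA.
by congr (_ + u 0 _ * v 0 _ + u 0 _ * v 0 _); apply: val_inj.
Qed.

Definition cross3 {R : realType} (u v : 'rV[R]_3) : 'rV[R]_3 :=
  \row_j [:: u 0 1 * v 0 2 - u 0 2 * v 0 1; u 0 2 * v 0 0 - u 0 0 * v 0 2;
             u 0 0 * v 0 1 - u 0 1 * v 0 0]`_j.

Lemma row3P {R : realType} (u v : 'rV[R]_3) :
  u 0 0 = v 0 0 -> u 0 1 = v 0 1 -> u 0 2 = v 0 2 -> u = v.
Proof.
move=> h0 h1 h2; apply/rowP => -[[|[|[|//]]] lti].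
- by rewrite (_ : Ordinal lti = 0)//; apply: val_inj.
- by rewrite (_ : Ordinal lti = 1)//; apply: val_inj.
- by rewrite (_ : Ordinal lti = 2)//; apply: val_inj.
Qed.

Lemma dot3C {R : realType} (u v : 'rV[R]_3) : dot3 u v = dot3 v u.
Proof. by rewrite !dot3E; ring. Qed.

Lemma dot3_ge0 {R : realType} (u : 'rV[R]_3) : 0 <= dot3 u u.
Proof. by rewrite dot3E; nra. Qed.

Lemma dot3_eq0 {R : realType} (u : 'rV[R]_3) : (dot3 u u == 0) = (u == 0).
Proof.
apply/eqP/eqP => [|->]; last by rewrite dot3E !mxE; ring.
by rewrite dot3E => h; apply: row3P; rewrite !mxE; nra.
Qed.

Lemma eucl_dist_ge0 {R : realType} (P Q : 'rV[R]_3) : 0 <= eucl_dist P Q.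
Proof. exact: sqrtr_ge0. Qed.

Lemma sqr_eucl_dist {R : realType} (P Q : 'rV[R]_3) :
  eucl_dist P Q ^+ 2 = dot3 (P - Q) (P - Q).
Proof. by rewrite sqr_sqrtr// dot3_ge0. Qed.

Lemma eucl_dist_eq0 {R : realType} (P Q : 'rV[R]_3) :
  (eucl_dist P Q == 0) = (P == Q).
Proof. by rewrite -sqrf_eq0 sqr_eucl_dist dot3_eq0 subr_eq0. Qed.

Lemma eucl_distC {R : realType} (P Q : 'rV[R]_3) :
  eucl_dist P Q = eucl_dist Q P.
Proof. by rewrite /eucl_dist; congr Num.sqrt; rewrite !dot3E !mxE; ring. Qed.

(** Squared area of the parallelogram spanned by [u] and [v]; its sign is the Cauchy-Schwarz
    inequality. *)
Definition gram3 {R : realType} (u v : 'rV[R]_3) : R :=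
  dot3 u u * dot3 v v - dot3 u v ^+ 2.

Lemma lagrange3 {R : realType} (u v : 'rV[R]_3) :
  dot3 (cross3 u v) (cross3 u v) = gram3 u v.
Proof. by rewrite /gram3 !dot3E !mxE/=; ring. Qed.

Lemma gram3_ge0 {R : realType} (u v : 'rV[R]_3) : 0 <= gram3 u v.
Proof. by rewrite -lagrange3 dot3_ge0. Qed.

(** Equality case of Cauchy-Schwarz: the vector is [|v|^2] times the part of [u] orthogonal to [v],
    and its squared length is [|v|^2] times the Gram determinant. *)
Lemma gram3_eq0 {R : realType} (u v : 'rV[R]_3) :
  gram3 u v = 0 -> dot3 v v *: u - dot3 u v *: v = 0.
Proof.
move=> h; apply/eqP; rewrite -dot3_eq0; apply/eqP.
suff -> : dot3 (dot3 v v *: u - dot3 u v *: v) (dot3 v v *: u - dot3 u v *: v)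
  = dot3 v v * gram3 u v by rewrite h mulr0.
by rewrite /gram3 !dot3E !mxE; ring.
Qed.

(** A squared triple product is the Gram determinant of [u], [a], [b], expanded here along [u]. *)
Lemma dot3_cross3_sqr {R : realType} (u a b : 'rV[R]_3) :
  dot3 u (cross3 a b) ^+ 2 =
  dot3 u u * gram3 a b - dot3 u a ^+ 2 * dot3 b b - dot3 u b ^+ 2 * dot3 a a
  + 2 * dot3 u a * dot3 u b * dot3 a b.
Proof. by rewrite /gram3 !dot3E !mxE/=; ring. Qed.

(** Cramer's rule in the plane of [a] and [b], completed by the normal component: [u] is recovered
    from its products with [a], [b] and [a x b]. *)
Lemma cross3_decomposition {R : realType} (u a b : 'rV[R]_3) :
  gram3 a b *: u = dot3 u (cross3 a b) *: cross3 a b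
    + (dot3 u a * dot3 b b - dot3 u b * dot3 a b) *: a
    + (dot3 u b * dot3 a a - dot3 u a * dot3 a b) *: b.
Proof. by apply: row3P; rewrite /gram3 !dot3E !mxE/=; ring. Qed.

(** * Angles *)

Lemma cosine_itv {R : realType} (P Q S : 'rV[R]_3) :
  -1 <= dot3 (P - Q) (S - Q) / (eucl_dist P Q * eucl_dist S Q) <= 1.
Proof.
rewrite -ler_norml -(@ler_pXn2r _ 2)// ?nnegrE//.
rewrite expr1n real_normK ?num_real// expr_div_n exprMn !sqr_eucl_dist.
have := gram3_ge0 (P - Q) (S - Q); rewrite /gram3 subr_ge0.
(* If [P = Q] or [S = Q], the quotient is 0 because the inverse of 0 is 0. *)
have [->|h] := eqVneq (dot3 (P - Q) (P - Q) * dot3 (S - Q) (S - Q)) 0.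
  by rewrite invr0 mulr0.
by rewrite ler_pdivrMr ?mul1r// lt0r h mulr_ge0 ?dot3_ge0.
Qed.

Lemma cos_angle {R : realType} (P Q S : 'rV[R]_3) :
  cos (angle P Q S) =
  dot3 (P - Q) (S - Q) / (eucl_dist P Q * eucl_dist S Q).
Proof. by rewrite acosK// in_itv/= cosine_itv. Qed.

Lemma sin_angle_ge0 {R : realType} (P Q S : 'rV[R]_3) :
  0 <= sin (angle P Q S).
Proof. by rewrite sin_acos ?cosine_itv// sqrtr_ge0. Qed.

Lemma dot3_angle {R : realType} (P Q S : 'rV[R]_3) :
  dot3 (P - Q) (S - Q) = eucl_dist P Q * eucl_dist S Q * cos (angle P Q S).
Proof.
rewrite cos_angle mulrC.
have [h|h] := eqVneq (eucl_dist P Q * eucl_dist S Q) 0; last by rewrite divfK.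
rewrite h mulr0; move/eqP: h; rewrite mulf_eq0 !eucl_dist_eq0.
by case/orP => /eqP ->; rewrite subrr dot3E !mxE; ring.
Qed.

Lemma gram3_angle {R : realType} (P Q S : 'rV[R]_3) :
  gram3 (P - Q) (S - Q)
  = (eucl_dist P Q * eucl_dist S Q * sin (angle P Q S)) ^+ 2.
Proof.
rewrite /gram3 (dot3_angle P Q S) -!sqr_eucl_dist !exprMn sin2cos2; ring.
Qed.


(* Projecting [P] on the line [QX] gives [|XQ| = |PQ| cos Q + |PX| cos X], and
   [|PX| sin X = |PQ| sin Q]. The degenerate positions [X = Q] and [P = Q] are
   covered since the angles involving them are then [acos 0]. *)
Lemma eucl_dist_two_angles {R : realType} {P Q X : 'rV[R]_3} :
  sin (angle P X Q) != 0 ->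
  eucl_dist X Q = eucl_dist P Q *
    (cos (angle P Q X)
     + sin (angle P Q X) * (cos (angle P X Q) / sin (angle P X Q))).
Proof.
set th := angle P Q X; set ph := angle P X Q => ph0.
have [XQ|XQ] := eqVneq X Q.
  have -> : cos th = 0.
    by rewrite cos_angle XQ subrr dot3C dot3E !mxE !mul0r !addr0 mul0r.
  have -> : cos ph = 0.
    by rewrite cos_angle XQ subrr dot3C dot3E !mxE !mul0r !addr0 mul0r.
  by rewrite mul0r mulr0 addr0 mulr0; apply/eqP; rewrite eucl_dist_eq0 XQ.
have t0 : eucl_dist X Q != 0 by rewrite eucl_dist_eq0.
have area : eucl_dist P X * sin ph = eucl_dist P Q * sin th.
  apply: (mulIf t0); apply/eqP.
  rewrite -(@eqrXn2 _ 2)// ?mulr_ge0 ?eucl_dist_ge0 ?sin_angle_ge0//; apply/eqP.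
  (* Both sides are now four times the squared area of the triangle [PQX], seen from [X] and from
     [Q]. *)
  transitivity (gram3 (P - X) (Q - X)).
    by rewrite gram3_angle (eucl_distC Q X) -/ph; ring.
  transitivity (gram3 (P - Q) (X - Q)); last by rewrite gram3_angle -/th; ring.
  by rewrite /gram3 !dot3E !mxE; ring.
have proj : eucl_dist X Q = eucl_dist P Q * cos th + eucl_dist P X * cos ph.
  apply: (mulIf t0).
  transitivity (dot3 (P - Q) (X - Q) + dot3 (P - X) (Q - X)).
    by rewrite -expr2 sqr_eucl_dist !dot3E !mxE; ring.
  by rewrite (dot3_angle P Q X) (dot3_angle P X Q) (eucl_distC Q X); ring.
rewrite proj mulrDr; congr (_ + _).
by rewrite mulrA -area; field.
Qed.

(** * Nondegenerate faces and the side of a face *)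

Lemma nondegenerate_affine_free {R : realType} (A1 A2 A3 A4 : 'rV[R]_3)
    (w1 w2 w3 w4 : R) :
  nondegenerate_tetrahedron A1 A2 A3 A4 ->
  w1 + w2 + w3 + w4 = 0 ->
  w1 *: A1 + w2 *: A2 + w3 *: A3 + w4 *: A4 = 0 ->
  [/\ w1 = 0, w2 = 0, w3 = 0 & w4 = 0].
Proof.
move=> /(@freeP _ _ 3 [tuple A2 - A1; A3 - A1; A4 - A1]) hA w0 h.
(* Eliminating [w1] turns the relation between points into one between the edges from [A1]. *)
have E : \sum_(i < 3) [:: w2; w3; w4]`_i *: [:: A2 - A1; A3 - A1; A4 - A1]`_i = 0.
  rewrite !big_ord_recl big_ord0/= -[RHS]h (_ : w1 = - w2 - w3 - w4); last by lra.
  by apply/rowP => j; rewrite !mxE; ring.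
have h2 := hA _ E 0; have h3 := hA _ E 1; have h4 := hA _ E 2.
by split => //; move: h2 h3 h4 => /=; lra.
Qed.

(** If the Gram determinant vanished, [gram3_eq0] would be an affine relation in which [P] has
    weight [|S - Q|^2], forcing [S = Q]; then [Q - S = 0] is a forbidden relation. *)
Lemma affine_free_gram3_neq0 {R : realType} (P Q S : 'rV[R]_3) :
  (forall x y z, x + y + z = 0 -> x *: P + y *: Q + z *: S = 0 ->
    x = 0 /\ z = 0) ->
  gram3 (P - Q) (S - Q) != 0.
Proof.
move=> free; apply/eqP => /gram3_eq0 h.
have [SQ _] := free (dot3 (S - Q) (S - Q))
  (dot3 (P - Q) (S - Q) - dot3 (S - Q) (S - Q)) (- dot3 (P - Q) (S - Q))
  ltac:(ring) ltac:(by rewrite -[RHS]h; apply/rowP => j; rewrite !mxE; ring).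
move/eqP: SQ; rewrite dot3_eq0 subr_eq0 => /eqP SQ.
have [] := free 0 1 (-1); rewrite ?SQ ?add0r ?subrr//.
  by rewrite scale0r add0r scaleN1r scale1r subrr.
by move=> _ /eqP; rewrite oppr_eq0 oner_eq0.
Qed.

Lemma gram3_sin_angle_neq0 {R : realType} (P Q S : 'rV[R]_3) :
  gram3 (P - Q) (S - Q) != 0 -> sin (angle P Q S) != 0.
Proof. by apply: contra => /eqP h; rewrite gram3_angle h mulr0 expr0n. Qed.

(** Since [n] is normal to the face [A1 A2 A3], only the barycentric weight [w4 >= 0] of [A4]
    survives in the product. *)
Lemma dot3_cross3_sg {R : realType} {A1 A2 A3 A4 P : 'rV[R]_3} :
  tetrahedron A1 A2 A3 A4 P ->
  let n := cross3 (A1 - A2) (A3 - A2) in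
  dot3 (P - A2) n = Num.sg (dot3 (A4 - A2) n) * Num.sqrt (dot3 (P - A2) n ^+ 2).
Proof.
case=> w1 [w2 [w3 [w4 [[w10 w20 w30 w40] w ->]]]] n.
have -> : dot3 (w1 *: A1 + w2 *: A2 + w3 *: A3 + w4 *: A4 - A2) n
    = w4 * dot3 (A4 - A2) n.
  rewrite (_ : w2 = 1 - w1 - w3 - w4); last by lra.
  by rewrite !dot3E !mxE/=; ring.
rewrite sqrtr_sqr normrM (ger0_norm w40) mulrCA; congr (_ * _).
by rewrite mulr_sg_norm.
Qed.

(** * Euclidean distances and convergence of trees *)

Lemma eucl_dist_segment {R : realType} (A B B' : 'rV[R]_3) (t : R) :
  0 <= t <= 1 ->
  eucl_dist ((1 - t) *: A + t *: B) ((1 - t) *: A + t *: B') <= eucl_dist B B'.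
Proof.
move=> /andP[t0 t1].
have -> : eucl_dist ((1 - t) *: A + t *: B) ((1 - t) *: A + t *: B')
    = t * eucl_dist B B'.
  rewrite /eucl_dist -[t in RHS](ger0_norm t0) -sqrtr_sqr -sqrtrM ?sqr_ge0//.
  by congr Num.sqrt; rewrite !dot3E !mxE; ring.
by rewrite ler_piMl// eucl_dist_ge0.
Qed.

Lemma cvg_eucl_dist {R : realType} (F : set_system R) (FF : Filter F)
    (f : R -> 'rV[R]_3) (A : 'rV[R]_3) :
  f x @[x --> F] --> A -> eucl_dist (f x) A @[x --> F] --> (0 : R).
Proof.
move=> fA.
have fi i : f x 0 i @[x --> F] --> A 0 i.
  exact: (cvg_comp f (fun M : 'rV_3 => M 0 i) fA (@coord_continuous _ _ _ 0 i A)).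
rewrite -[X in _ --> X](@sqrtr0 R).
apply: (@continuous_cvg _ _ _ F FF (fun x => dot3 (f x - A) (f x - A)) Num.sqrt 0).
  exact: sqrt_continuous.
have di i : (f x - A) 0 i @[x --> F] --> (0 : R).
  rewrite -(subrr (A 0 i)).
  under eq_cvg do rewrite !mxE.
  by apply: cvgB => //; exact: cvg_cst.
rewrite (_ : 0 = 0 * 0 + 0 * 0 + 0 * 0 :> R); last by ring.
under eq_cvg do rewrite dot3E.
by apply: cvgD; [apply: cvgD|]; apply: cvgM.
Qed.

(** Points with the same parameter on [A A0] and [A A4] are at distance at most [|A0 A4|]. *)
Lemma tree_cvg_vertex {R : realType} (F : set_system R) (FF : Filter F)
    (A1 A2 A3 A4 : 'rV[R]_3) (A0 : R -> 'rV[R]_3) :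
  A0 x @[x --> F] --> A4 ->
  tree_cvg F
    (fun x => [set segment A1 (A0 x); segment A2 (A0 x);
                   segment A3 (A0 x); segment A4 (A0 x)])
    [set segment A1 A4; segment A2 A4; segment A3 A4].
Proof.
move=> /cvg_eucl_dist A04 r r0.
have : \forall x \near F, eucl_dist (A0 x) A4 < r.
  by apply: (cvgr_lt _ A04).
apply: filterS => x xr.
have close A t : `[0, 1]%classic t ->
    eucl_dist ((1 - t) *: A + t *: A0 x) ((1 - t) *: A + t *: A4) < r.
  by rewrite /= in_itv/= => /eucl_dist_segment/le_lt_trans; apply.
split.
- move=> _ [_ [[[]->|->]|->] [t t01 <-]]; (eexists; last exact: close t01) => //.
  + by exists (segment A1 A4); [do 2 left|exists t].
  + by exists (segment A2 A4); [left; right|exists t].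
  + by exists (segment A3 A4); [right|exists t].
  (* The segment [A4 A0] shrinks to [A4], found in the limit tree as the end of [A1 A4]. *)
  + exists (segment A1 A4); [by do 2 left|exists 1].
      by rewrite /= in_itv/= ler01 lexx.
    by rewrite -scalerDl subrK subrr scale0r add0r.
- move=> _ [_ [[]->|->] [t t01 <-]]; (eexists; last exact: close t01).
  + by exists (segment A1 (A0 x)); [do 3 left|exists t].
  + by exists (segment A2 (A0 x)); [left; left; right|exists t].
  + by exists (segment A3 (A0 x)); [left; right|exists t].
Qed.

(** * From convergence of angles to convergence of points *)

Lemma angle_cvg_vertex {R : realType} (F : set_system R) (FF : Filter F)
    (A1 A2 A3 A4 : 'rV[R]_3) (A0 : R -> 'rV[R]_3) :
  nondegenerate_tetrahedron A1 A2 A3 A4 ->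
  (\forall x \near F, tetrahedron A1 A2 A3 A4 (A0 x)) ->
  angle A1 A2 (A0 x) @[x --> F] --> angle A1 A2 A4 ->
  angle A1 (A0 x) A2 @[x --> F] --> angle A1 A4 A2 ->
  angle (A0 x) A2 A3 @[x --> F] --> angle A4 A2 A3 ->
  A0 x @[x --> F] --> A4.
Proof.
move=> hA hT h120 h102 h023.
have hs : sin (angle A1 A4 A2) != 0.
  apply/gram3_sin_angle_neq0/affine_free_gram3_neq0 => x y z xyz h.
  (* A relation within a face is one between the four vertices with weight 0 on the opposite one. *)
  have [] // := @nondegenerate_affine_free _ A1 A2 A3 A4 x z 0 y hA.
    by lra.
  by rewrite -[RHS]h; apply/rowP => j; rewrite !mxE; ring.
have hg : gram3 (A1 - A2) (A3 - A2) != 0.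
  apply: affine_free_gram3_neq0 => x y z xyz h.
  have [] // := @nondegenerate_affine_free _ A1 A2 A3 A4 x y z 0 hA.
    by lra.
  by rewrite -[RHS]h; apply/rowP => j; rewrite !mxE; ring.
have cosF (f : R -> R) a : f x @[x --> F] --> a -> cos (f x) @[x --> F] --> cos a.
  by move=> fa; exact: (cvg_comp f cos fa (@continuous_cos R a)).
have sinF (f : R -> R) a : f x @[x --> F] --> a -> sin (f x) @[x --> F] --> sin a.
  by move=> fa; exact: (cvg_comp f sin fa (@continuous_sin R a)).
have hd : eucl_dist (A0 x) A2 @[x --> F] --> eucl_dist A4 A2.
  rewrite (eucl_dist_two_angles hs).
  apply: (cvg_trans (near_eq_cvg (f := fun x => eucl_dist A1 A2 *
    (cos (angle A1 A2 (A0 x)) + sin (angle A1 A2 (A0 x)) *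
      (cos (angle A1 (A0 x) A2) / sin (angle A1 (A0 x) A2)))) _)).
    (* The formula needs a nonzero sine at [A0 x], which holds eventually since the limit sine is
       nonzero. *)
    near=> x; apply/esym/eucl_dist_two_angles.
    near: x.
    exact: (cvgr_neq0 _ (sinF _ _ h102) hs).
  apply: cvgM; first exact: cvg_cst.
  apply: cvgD; first exact: cosF.
  apply: cvgM; first exact: sinF.
  by apply: cvgM; [exact: cosF|apply: cvgV => //; exact: sinF].
set a := A1 - A2; set b := A3 - A2.
have hda : dot3 (A0 x - A2) a @[x --> F] --> dot3 (A4 - A2) a.
  rewrite dot3C dot3_angle; under eq_cvg do rewrite dot3C dot3_angle.
  by apply: cvgM; [apply: cvgM => //; exact: cvg_cst|exact: cosF].
have hdb : dot3 (A0 x - A2) b @[x --> F] --> dot3 (A4 - A2) b.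
  rewrite dot3_angle; under eq_cvg do rewrite dot3_angle.
  by apply: cvgM; [apply: cvgM => //; exact: cvg_cst|exact: cosF].
have hdd : dot3 (A0 x - A2) (A0 x - A2) @[x --> F] --> dot3 (A4 - A2) (A4 - A2).
  rewrite -sqr_eucl_dist expr2; under eq_cvg do rewrite -sqr_eucl_dist expr2.
  exact: cvgM.
have hdn : dot3 (A0 x - A2) (cross3 a b) @[x --> F] -->
           dot3 (A4 - A2) (cross3 a b).
  (* The sign formula also applies to the limit [A4], so only the squares remain to be compared;
     they are polynomials in scalar products whose limits are known. *)
  have T4 : tetrahedron A1 A2 A3 A4 A4.
    exists 0, 0, 0, 1; split; [by split|by rewrite !add0r|].
    by rewrite !scale0r !add0r scale1r.
  rewrite (dot3_cross3_sg T4).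
  apply: (cvg_trans (near_eq_cvg (f := fun x =>
     Num.sg (dot3 (A4 - A2) (cross3 a b)) *
     Num.sqrt (dot3 (A0 x - A2) (cross3 a b) ^+ 2)) _)).
    by apply: filterS hT => x /dot3_cross3_sg/esym.
  apply: cvgM; first exact: cvg_cst.
  apply: (@continuous_cvg _ _ _ F FF
    (fun x => dot3 (A0 x - A2) (cross3 a b) ^+ 2) Num.sqrt).
    exact: sqrt_continuous.
  under eq_cvg do rewrite dot3_cross3_sqr !expr2.
  rewrite dot3_cross3_sqr !expr2.
  by repeat first [exact: cvg_cst|assumption|apply: cvgD
    |apply: cvgN|apply: cvgM].
have E P : P = (gram3 a b)^-1 *: (dot3 (P - A2) (cross3 a b) *: cross3 a b
    + (dot3 (P - A2) a * dot3 b b - dot3 (P - A2) b * dot3 a b) *: a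
    + (dot3 (P - A2) b * dot3 a a - dot3 (P - A2) a * dot3 a b) *: b) + A2.
  by rewrite -cross3_decomposition scalerA mulVf// scale1r subrK.
rewrite [X in _ --> X]E; under eq_cvg do rewrite [A0 _]E.
by repeat first [exact: cvg_cst|assumption|apply: cvgZ|apply: cvgD|apply: cvgN|apply: cvgM].
Unshelve. all: by end_near. Qed.

(* E is the set of parameters eps for which A0 eps is given; it accumulates
   at 0, and eps -> 0 means eps -> 0 within E, eps <> 0 (E = `]0, d[ gives the
   limit from the right). *)
Theorem corollary3 (R : realType) (A1 A2 A3 A4 : 'rV[R]_3)
    (hA : nondegenerate_tetrahedron A1 A2 A3 A4)
    (C : R) (hC : 0 < C) (k142 k203 k143 k423 : rat)
    (E : set R) (hE : limit_point E 0)
    (A0 : R -> 'rV[R]_3)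
    (hint : forall eps, E eps -> interior (tetrahedron A1 A2 A3 A4) (A0 eps))
    (h120 : forall eps, E eps ->
      angle A1 A2 (A0 eps) = angle A1 A2 A4 - eps)
    (h102 : forall eps, E eps ->
      angle A1 (A0 eps) A2 = angle A1 A4 A2 + ratr k142 * eps)
    (h203 : forall eps, E eps ->
      angle A2 (A0 eps) A3 = angle A2 A4 A3 + ratr k203 * eps)
    (h103 : forall eps, E eps ->
      angle A1 (A0 eps) A3 = angle A1 A4 A3 + ratr k143 * eps)
    (h023 : forall eps, E eps ->
      angle (A0 eps) A2 A3 = angle A4 A2 A3 + ratr k423 * eps)
    (B1 B2 B3 B4 : R -> R)
    (hBpos : forall eps, E eps ->
      [/\ 0 < B1 eps, 0 < B2 eps, 0 < B3 eps & 0 < B4 eps])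
    (hBsum : forall eps, E eps -> B1 eps + B2 eps + B3 eps + B4 eps = C)
    (hFT : forall eps, E eps ->
      is_fermat_torricelli A1 A2 A3 A4
        (B1 eps) (B2 eps) (B3 eps) (B4 eps) (A0 eps)) :
  tree_cvg (within E (dnbhs 0))
    (fun eps => [set segment A1 (A0 eps); segment A2 (A0 eps);
                     segment A3 (A0 eps); segment A4 (A0 eps)])
    [set segment A1 A4; segment A2 A4; segment A3 A4]
  /\ A0 eps @[eps --> within E (dnbhs 0)] --> A4.
Proof.
set F := within E (dnbhs 0).
have onE (P : R -> Prop) :
    (forall eps, E eps -> P eps) -> \forall eps \near F, P eps.
  by move=> PE; exact: filterS PE (withinT E _).
have id0 : eps @[eps --> F] --> (0 : R).
  by move=> U /nbhs_dnbhs; exact: cvg_within.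
have affine_cvg (f : R -> R) (a k : R) :
    (forall eps, E eps -> f eps = a + k * eps) -> f eps @[eps --> F] --> a.
  move=> fE; apply: (cvg_trans (near_eq_cvg (f := fun eps => a + k * eps) _)).
    by apply: onE => eps /fE.
  (* The limit is put in the shape of the function, for the sum and product rules. *)
  have -> : nbhs a = nbhs (a + k * 0) by rewrite mulr0 addr0.
  by apply: cvgD; [exact: cvg_cst|apply: cvgM => //; exact: cvg_cst].
have A04 : A0 eps @[eps --> F] --> A4.
  apply: (@angle_cvg_vertex _ _ _ A1 A2 A3) => //.
  - by apply: onE => eps /hint; exact: interior_subset.
  - by apply: (affine_cvg _ _ (-1)) => eps /h120 ->; rewrite mulN1r.
  - exact: affine_cvg h102.
  - exact: affine_cvg h023.
by split=> //; exact: tree_cvg_vertex.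
Qed.
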